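(* Let $A\in R(\Omega)$, with associated sequences $(a_n),(b_n),(c_n),(d_n)$ having limits $a,b,c,d$, be such that the involution kernel $W$ of $A$ based at $x'=0^\infty$ exists. Then $W(y|0^\infty)=0$ for all $y$, and for all $k,l\in\mathbb N$ (where $y=[u]$ or $x=[u]$ means that the sequence $y_1y_2\dots$, respectively $x_1x_2\dots$, begins with the finite word $u$): For $y=0^\infty$: - $x=[0^k1]$: $W(y|x)=\sum_{n=1}^\infty(a_{n+k}-a)$; - $x=1^\infty$: $W(y|x)=b-a+\sum_{n=2}^\infty(a_n-a)$; - $x=[1^k0]$: $W(y|x)=b_k-a+\sum_{n=2}^\infty(a_n-a)$. For $y=[0^l1]$: - $x=[0^k1]$: $W(y|x)=\sum_{n=1}^l(a_{n+k}-a)+d_{l+k}-d$; - $x=1^\infty$: $W(y|x)=(b-a)+\sum_{n=2}^l(a_n-a)+d_l-d$; - $x=[1^k0]$: $W(y|x)=b_k-a+\sum_{n=2}^l(a_n-a)+d_l-d$. For $y=1^\infty$: - $x=[0^k1]$: $W(y|x)=d_k-d$; - $x=1^\infty$: $W(y|x)=c-d+\sum_{n=2}^\infty(c-c_n)$; - $x=[1^k0]$: $W(y|x)=c_{k+1}-d+\sum_{n=2}^\infty(c_{n+k}-c_n)$. For $y=[1^l0]$: - $x=[0^k1]$: $W(y|x)=d_k-d$; - $x=1^\infty$: $W(y|x)=c-d+\sum_{n=2}^l(c-c_n)+b-b_l$; - $x=[1^k0]$: $W(y|x)=c_{k+1}-d+\sum_{n=2}^l(c_{n+k}-c_n)+b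_{l+k}-b_l$.
   Context: $\mathbb N=\{1,2,\dots\}$, $\Omega=\{0,1\}^{\mathbb N}$ with the product topology. $\Omega^-$ is a copy of $\Omega$ whose points are written $y=(y_1,y_2,\dots)$; $\hat\Omega=\Omega^-\times\Omega$, with points $(y|x)=(\dots,y_2,y_1|x_1,x_2,\dots)$. The Walters family $R(\Omega)$ is the set of continuous $A:\Omega\to\mathbb R$ for which there are convergent real sequences $(a_n),(b_n),(c_n),(d_n)$ such that for all $n\in\mathbb N$, $w\in\Omega$: $A(0^{n+1}1w)=a_{n+1}$, $A(01^n0w)=b_n$, $A(1^{n+1}0w)=c_{n+1}$, $A(10^n1w)=d_n$. The involution kernel of $A$ based at $x'\in\Omega$ is $W(y|x)=\sum_{n\ge1}[A(y_n,\dots,y_1,x_1,x_2,\dots)-A(y_n,\dots,y_1,x'_1,x'_2,\dots)]$; it exists if this series converges for every $(y|x)\in\hat\Omega$. *)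

(* Defs.v *)
From HB Require Import structures.
From mathcomp Require Import all_boot all_order all_algebra.
From mathcomp Require Import all_classical all_reals all_analysis.
Set Implicit Arguments.
Unset Strict Implicit.
Unset Printing Implicit Defensive.
Import Order.TTheory GRing.Theory Num.Theory.
Import numFieldNormedType.Exports.
Local Open Scope classical_set_scope.
Local Open Scope ring_scope.

(* The library has this notation for extended reals only. *)
Notation "\sum_ ( m <= i '<oo' ) F" :=
  (\big[+%R/0%R]_(m <= i <oo) F%R) : ring_scope.

(* {0,1}^N with the product topology, 0 = false and 1 = true. Coordinates are
   0-based: the letter x_i (i >= 1) of a sequence x is [x i.-1]. *)
Notation Omega := cantor_space.

(* The sequence u_1 ... u_m x_1 x_2 ... *)
Definition prepend (u : seq bool) (x : Omega) : Omega :=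
  fun i => if (i < size u)%N then nth false u i else x (i - size u)%N.

(* x = [u] *)
Definition begins_with (u : seq bool) (x : Omega) : Prop :=
  mkseq x (size u) = u.

Definition zeros : Omega := fun=> false.
Definition ones : Omega := fun=> true.

(* w01 n is the word 0^n 1, with n zeros, and w10 n is the word 1^n 0. *)
Definition w0 (n : nat) : seq bool := nseq n false.
Definition w1 (n : nat) : seq bool := nseq n true.
Definition w01 (n : nat) : seq bool := rcons (w0 n) true.
Definition w10 (n : nat) : seq bool := rcons (w1 n) false.

(* [summable_from m u]: the series u_m + u_(m+1) + ... converges; its sum is
   then [\sum_(m <= n <oo) u n], which is a mere default value otherwise. *)
Definition summable_from (R : realType) (m : nat) (u : nat -> R) : Prop :=
  cvgn (fun N : nat => \sum_(m <= n < N) u n).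

(* The values a 0, a 1, b 0, c 0, c 1 and d 0 play no role: sequences are
   indexed by n >= 1 and a_1, c_1 are unconstrained. *)
Definition walters_sequences (R : realType) (A : Omega -> R)
    (a b c d : nat -> R) : Prop :=
  [/\ cvgn a, cvgn b, cvgn c, cvgn d &
    forall n : nat, (1 <= n)%N -> forall w : Omega,
    [/\ A (prepend (w01 n.+1) w) = a n.+1,
        A (prepend (false :: w10 n) w) = b n,
        A (prepend (w10 n.+1) w) = c n.+1 &
        A (prepend (true :: w01 n) w) = d n]].

Definition walters_family (R : realType) (A : Omega -> R) : Prop :=
  continuous A /\ exists a b c d, walters_sequences A a b c d.

(* The word y_n ... y_1. *)
Definition past (y : Omega) (n : nat) : seq bool := rev (mkseq y n).

(* n-th term (n >= 1) of the series defining the involution kernel based at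
   x', at the point (y|x). *)
Definition kernel_term (R : realType) (A : Omega -> R) (x' y x : Omega)
    (n : nat) : R :=
  A (prepend (past y n) x) - A (prepend (past y n) x').

Definition involution_kernel_exists (R : realType) (A : Omega -> R)
    (x' : Omega) : Prop :=
  forall y x : Omega, summable_from 1 (kernel_term A x' y x).

Definition involution_kernel (R : realType) (A : Omega -> R)
    (x' y x : Omega) : R :=
  \sum_(1 <= n <oo) kernel_term A x' y x n.

(* Main.v *)
Require Import Defs.
From HB Require Import structures.
From mathcomp Require Import all_boot all_order all_algebra.
From mathcomp Require Import all_classical all_reals all_analysis.
Import Order.TTheory GRing.Theory Num.Theory.
Import numFieldNormedType.Exports.
Local Open Scope classical_set_scope.
Local Open Scope ring_scope.

(** The value of [A] at a sequence is fixed by its first run when that run has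
    length at least 2, and by its first two runs otherwise. Hence, once the past
    [y_n ... y_1] contains both letters after its first letter, the n-th term of
    the kernel series vanishes. If [y] starts with a run of length [l], only the
    terms [n <= l + 1] survive, and each of them is read off from the four
    sequences; the values of [A] at the base point are the limits of these
    sequences, by continuity. *)

(** * Words, prefixes and pasts *)

Lemma prepend_cat (u v : seq bool) (x : Omega) :
  prepend (u ++ v) x = prepend u (prepend v x).
Proof.
apply/funext => i; rewrite /prepend size_cat nth_cat subnDA.
have [iu|ui] := ltnP i (size u); first by rewrite ltn_addr.
by rewrite ltn_subLR.
Qed.

Lemma prepend_nseqD (e : bool) (n k : nat) (x : Omega) :
  prepend (nseq n e) (prepend (nseq k e) x) = prepend (nseq (n + k) e) x.
Proof. by rewrite -prepend_cat -nseqD. Qed.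

Lemma prepend_nseq_const (e : bool) (n : nat) :
  prepend (nseq n e) (fun=> e) = (fun=> e).
Proof. by apply/funext => i; rewrite /prepend nth_nseq size_nseq; case: ltnP. Qed.

Lemma prepend_nseq_head (e : bool) (n : nat) (x : Omega) :
  (1 <= n)%N -> prepend (nseq n e) x 0%N = e.
Proof. by case: n. Qed.

Lemma prepend_head (x : Omega) : x = prepend [:: x 0%N] (fun i => x i.+1).
Proof. by apply/funext => -[|i] //; rewrite /prepend /= subn1. Qed.

(** The instances [e = false] and [e = true] are [w01 k] and [w10 k] up to conversion. The letter
    [~~ e] stays in the tail [z], so that the run can merge with a past by [prepend_nseqD]. *)
Lemma begins_with_run (e : bool) (k : nat) (x : Omega) :
  begins_with (rcons (nseq k e) (~~ e)) x ->
  exists2 z : Omega, z 0%N = ~~ e & x = prepend (nseq k e) z.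
Proof.
rewrite /begins_with size_rcons size_nseq => xE.
have xn n : (n < k.+1)%N -> x n = nth false (rcons (nseq k e) (~~ e)) n.
  by move=> nk; rewrite -xE nth_mkseq.
exists (fun i => x (i + k)%N).
  by rewrite add0n xn // nth_rcons size_nseq ltnn eqxx.
apply/funext => i; rewrite /prepend size_nseq.
have [ik|ki] := ltnP i k; last by rewrite subnK.
by rewrite (xn i (ltnW ik)) nth_rcons size_nseq ik.
Qed.

Lemma pastS (y : Omega) (n : nat) : past y n.+1 = y n :: past y n.
Proof. by rewrite /past mkseqS rev_rcons. Qed.

Lemma past_const (e : bool) (n : nat) : past (fun=> e) n = nseq n e.
Proof. by elim: n => // n IHn; rewrite pastS IHn. Qed.

Lemma past_begins_with (y : Omega) (v : seq bool) (n : nat) :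
  begins_with v y -> (n <= size v)%N -> past y n = rev (take n v).
Proof.
move=> vE nv; rewrite /past -[in RHS]vE /mkseq -map_take take_iota.
by rewrite (minn_idPl nv).
Qed.

Lemma mem_past (y : Omega) (i n : nat) : (i < n)%N -> y i \in past y n.
Proof.
move=> i_n; rewrite mem_rev; apply/mapP; exists i => //.
by rewrite mem_iota add0n.
Qed.

Lemma past_run (e : bool) (l n : nat) (y : Omega) :
  begins_with (rcons (nseq l e) (~~ e)) y -> (n <= l)%N -> past y n = nseq n e.
Proof.
move=> yE nl; rewrite (past_begins_with _ _ _ yE).
  by rewrite -cats1 takel_cat ?size_nseq // take_nseq // rev_nseq.
by rewrite size_rcons size_nseq ltnW.
Qed.

Lemma past_run_last (e : bool) (l : nat) (y : Omega) :
  begins_with (rcons (nseq l e) (~~ e)) y -> past y l.+1 = ~~ e :: nseq l e.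
Proof.
move=> yE; rewrite (past_begins_with _ _ _ yE) ?size_rcons ?size_nseq //.
by rewrite take_oversize ?rev_rcons ?rev_nseq // size_rcons size_nseq.
Qed.

Lemma split_first_run (e : bool) (s : seq bool) :
  ~~ e \in s -> exists n t, s = nseq n e ++ ~~ e :: t.
Proof.
elim: s => // f s IHs; have [->|] := eqVneq f (~~ e).
  by exists 0%N, s.
case: f e IHs => -[] // IHs _; rewrite inE /= => /IHs[n [t ->]].
  by exists n.+1, t.
by exists n.+1, t.
Qed.

(** * Convergence in the Cantor space and values of continuous functions *)

Lemma cvg_cantor (z : nat -> Omega) (x : Omega) :
  (forall i n, (i < n)%N -> z n i = x i) -> z n @[n --> \oo] --> x.
Proof.
move=> zx; apply/cvg_sup => i U [V] [[W] oW <-] Wx WU.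
(* A subbasic neighbourhood constrains only coordinate [i], which has its final value from index
   [i.+1] on. *)
apply: (filterS WU); rewrite nbhs_simpl; exists i.+1 => // n /= /zx zxn.
by rewrite /proj zxn.
Qed.

(** The points v e^n (~e) 0^oo tend to v e^oo; continuity and uniqueness of limits do the rest. *)
Lemma continuous_run_lim (R : realType) (A : Omega -> R) (v : seq bool)
    (e : bool) (s : nat -> R) (l : R) :
  continuous A ->
  (forall n, (1 <= n)%N ->
    A (prepend (v ++ rcons (nseq n e) (~~ e)) zeros) = s n) ->
  s n @[n --> \oo] --> l -> A (prepend v (fun=> e)) = l.
Proof.
move=> Ac As sl.
pose z n := prepend (v ++ rcons (nseq n e) (~~ e)) zeros.
have zc : z n @[n --> \oo] --> (prepend v (fun=> e) : Omega).
  apply: cvg_cantor => i n i_n; rewrite /z prepend_cat /prepend.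
  case: ifP => // _; rewrite size_rcons size_nseq.
  have ivn : (i - size v < n)%N by rewrite (leq_ltn_trans _ i_n) ?leq_subr.
  by rewrite ltnS (ltnW ivn) nth_rcons size_nseq ivn nth_nseq ivn.
have Az : A (z n) @[n --> \oo] --> A (prepend v (fun=> e)).
  exact: (cvg_comp _ _ zc (Ac _)).
have : s n @[n --> \oo] --> A (prepend v (fun=> e)).
  (* [s] gives the values only from index 1 on, hence an eventual equality. *)
  apply: cvg_trans Az; apply: near_eq_cvg.
  by exists 1%N => // n /= n1; rewrite -As.
by move=> sA; apply: (cvg_unique _ sA sl).
Qed.

(** * Splitting and truncation of series *)

Section Series.
Set Implicit Arguments.
Unset Strict Implicit.
Context (R : realType).
Implicit Types (u v : nat -> R) (m N : nat).

Lemma eq_summable_from m u v :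
  (forall n, (m <= n)%N -> u n = v n) -> summable_from m u ->
  summable_from m v /\ \sum_(m <= n <oo) u n = \sum_(m <= n <oo) v n.
Proof.
move=> uv.
have -> : \sum_(m <= n <oo) u n = \sum_(m <= n <oo) v n.
  congr (limn _); apply/funext => N.
  by apply: eq_big_nat => n /andP[+ _]; exact: uv.
rewrite /summable_from.
suff -> : (fun N => \sum_(m <= n < N) u n) = (fun N => \sum_(m <= n < N) v n).
  by [].
by apply/funext => N; apply: eq_big_nat => n /andP[+ _]; exact: uv.
Qed.

(** The partial sums from [m] and from [m.+1] differ by [u m] once [N > m]; for smaller [N] both are
    empty, so the comparison is only eventual. *)
Lemma summable_from_recl m u : summable_from m u ->
  summable_from m.+1 u /\
  \sum_(m <= n <oo) u n = u m + \sum_(m.+1 <= n <oo) u n.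
Proof.
move=> su; have cu : (\sum_(m.+1 <= n < N) u n) @[N --> \oo]
    --> - u m + \sum_(m <= n <oo) u n.
  apply: (cvg_trans _ (cvgD (cvg_cst (- u m)) su)); apply: near_eq_cvg.
  exists m.+1 => // N /= mN; by rewrite /= !fctE (big_ltn mN) addKr.
split; first by apply: cvgP cu.
by rewrite (cvg_lim _ cu) // addrA addrN add0r.
Qed.

Lemma series_eventually0 m N u : (m <= N)%N ->
  (forall n, (N <= n)%N -> u n = 0) ->
  \sum_(m <= n <oo) u n = \sum_(m <= n < N) u n.
Proof.
move=> mN u0; apply: lim_near_cst => //.
exists N => // M /= NM; rewrite (big_cat_nat mN NM) /=.
rewrite [X in _ + X]big1_seq ?addr0 // => i /=.
by rewrite mem_index_iota => /andP[+ _]; exact: u0.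
Qed.

End Series.

(** * Values of a Walters function on words, and truncation of its kernel *)

Section WaltersValues.
Set Implicit Arguments.
Unset Strict Implicit.
Context (R : realType) (A : Omega -> R) (a b c d : nat -> R).
Context (A_seqs : walters_sequences A a b c d).
Implicit Types (x y z : Omega) (e : bool) (n k l : nat).

(** Here and in the next three lemmas the letter ending the run is the head of [x] instead of the
    end of the word, so that any tail can be fed in. A run of length 1 alone does not fix the value,
    hence the bound 2. *)
Lemma walters_a n x : (2 <= n)%N -> x 0%N = true ->
  A (prepend (nseq n false) x) = a n.
Proof.
case: A_seqs => _ _ _ _ As; case: n => [|[|n]] // _ x0.
rewrite (prepend_head x) x0 -prepend_cat cats1.
by case: (As n.+1 isT (fun i => x i.+1)).
Qed.

Lemma walters_b n x : (1 <= n)%N -> x 0%N = false ->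
  A (prepend (false :: nseq n true) x) = b n.
Proof.
case: A_seqs => _ _ _ _ As n1 x0; rewrite (prepend_head x) x0 -prepend_cat cats1.
by case: (As n n1 (fun i => x i.+1)).
Qed.

Lemma walters_c n x : (2 <= n)%N -> x 0%N = false ->
  A (prepend (nseq n true) x) = c n.
Proof.
case: A_seqs => _ _ _ _ As; case: n => [|[|n]] // _ x0.
rewrite (prepend_head x) x0 -prepend_cat cats1.
by case: (As n.+1 isT (fun i => x i.+1)).
Qed.

Lemma walters_d n x : (1 <= n)%N -> x 0%N = true ->
  A (prepend (true :: nseq n false) x) = d n.
Proof.
case: A_seqs => _ _ _ _ As n1 x0; rewrite (prepend_head x) x0 -prepend_cat cats1.
by case: (As n n1 (fun i => x i.+1)).
Qed.

(* The letter [~~ e] of [s] ends the first run; if [s] starts with [~~ e], the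
   letter [e] of [s] ends the second run as well. *)
Lemma walters_prepend_const e s x x' : true \in s -> false \in s ->
  A (prepend (e :: s) x) = A (prepend (e :: s) x').
Proof.
case: s => // f s sT sF; have [ef|nef] := eqVneq f e.
  have : ~~ e \in f :: s by case: (e).
  move=> /split_first_run[n [t fsE]]; rewrite fsE.
  (* [n = 0] contradicts [ef]; otherwise the leading [e] joins a run of total length [n.+2]. *)
  case: n fsE => [[fE _]|n _]; first by move: ef; rewrite fE; case: (e).
  rewrite (prepend_cat (nseq n.+2 e)) (prepend_cat (nseq n.+2 e) _ x').
  by case: (e); rewrite ?walters_a ?walters_c.
have : e \in f :: s by case: (e).
(* Reading [e] as [~~ ~~ e] isolates the run of [~~ e] that follows the leading letter. *)
rewrite -[X in X \in _]negbK => /split_first_run[n [t fsE]]; rewrite fsE.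
case: n fsE => [[fE _]|n _]; first by move: nef; rewrite fE; case: (e).
rewrite negbK (prepend_cat (e :: nseq n.+1 (~~ e))).
rewrite (prepend_cat (e :: nseq n.+1 (~~ e)) _ x').
by case: (e); rewrite ?walters_b ?walters_d.
Qed.

(** Up to [l] the past is e^n, and at [l.+1] it is (~e) e^l. Every later past has both letters after
    its first one, so [walters_prepend_const] kills its term. *)
Lemma involution_kernel_run e l x' x y : (1 <= l)%N ->
  begins_with (rcons (nseq l e) (~~ e)) y ->
  involution_kernel A x' y x =
  \sum_(1 <= n < l.+1) (A (prepend (nseq n e) x) - A (prepend (nseq n e) x')) +
  (A (prepend (~~ e :: nseq l e) x) - A (prepend (~~ e :: nseq l e) x')).
Proof.
move=> l1 yE; rewrite /involution_kernel (@series_eventually0 _ _ l.+2) //.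
  rewrite big_nat_recr //= /kernel_term (past_run_last _ _ _ yE).
  congr (_ + _); apply: eq_big_nat => n /andP[_ nl].
  by rewrite (past_run _ _ _ _ yE).
(* The index is now [n.+1] with [l < n]: without its first letter the past is [past y n], which
   still covers the first [l.+1] letters of [y]. *)
case=> // n ln; rewrite /kernel_term pastS.
have lastP : {subset ~~ e :: nseq l e <= past y n}.
  rewrite -(past_run_last _ _ _ yE) => t; rewrite !mem_rev => /mapP[i + ->].
  rewrite mem_iota add0n => /andP[_ il].
  by rewrite -mem_rev mem_past // (leq_trans il).
have e1 : ~~ e \in past y n by apply: lastP; rewrite mem_head.
have e2 : e \in past y n by apply: lastP; rewrite inE mem_nseq l1 eqxx orbT.
rewrite (@walters_prepend_const (y n) _ x x') ?subrr //; by case: (e) e1 e2.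
Qed.

End WaltersValues.

(** * Values at 0^oo, 1^oo, 01^oo and 10^oo *)

Section WaltersKernel.
Set Implicit Arguments.
Unset Strict Implicit.
Context (R : realType) (A : Omega -> R) (a b c d : nat -> R) (la lb lc ld : R).
Context (A_seqs : walters_sequences A a b c d) (A_cont : continuous A).
Context (a_lim : a n @[n --> \oo] --> la) (b_lim : b n @[n --> \oo] --> lb).
Context (c_lim : c n @[n --> \oo] --> lc) (d_lim : d n @[n --> \oo] --> ld).

Lemma walters_zeros : A zeros = la.
Proof.
(* Splitting off one letter makes the approximating runs have length [n.+1], at least 2, where [a]
   gives the values. *)
rewrite -[zeros](prepend_nseq_const false 1).
apply: (@continuous_run_lim _ _ _ _ (fun n => a n.+1) _ A_cont).
  by case: A_seqs => _ _ _ _ As n n1; case: (As n n1 zeros).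
by rewrite (cvg_shiftS a).
Qed.

Lemma walters_ones : A ones = lc.
Proof.
rewrite -[ones](prepend_nseq_const true 1).
apply: (@continuous_run_lim _ _ _ _ (fun n => c n.+1) _ A_cont).
  by case: A_seqs => _ _ _ _ As n n1; case: (As n n1 zeros).
by rewrite (cvg_shiftS c).
Qed.

Lemma walters_false_ones : A (prepend [:: false] ones) = lb.
Proof.
apply: (@continuous_run_lim _ _ _ _ b _ A_cont) => // n n1.
by case: A_seqs => _ _ _ _ /(_ n n1 zeros)[].
Qed.

Lemma walters_true_zeros : A (prepend [:: true] zeros) = ld.
Proof.
apply: (@continuous_run_lim _ _ _ _ d _ A_cont) => // n n1.
by case: A_seqs => _ _ _ _ /(_ n n1 zeros)[].
Qed.

End WaltersKernel.

Theorem mainTheorem3 (R : realType) (A : Omega -> R) (a b c d : nat -> R)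
    (la lb lc ld : R)
    (A_walters : walters_family A)
    (A_seqs : walters_sequences A a b c d)
    (a_lim : a n @[n --> \oo] --> la) (b_lim : b n @[n --> \oo] --> lb)
    (c_lim : c n @[n --> \oo] --> lc) (d_lim : d n @[n --> \oo] --> ld)
    (W_exists : involution_kernel_exists A zeros) :
  let W := involution_kernel A zeros in
  (forall y : Omega, W y zeros = 0) /\
  forall k l : nat, (1 <= k)%N -> (1 <= l)%N ->
  [/\ (* y = 0^oo *)
      [/\ forall x : Omega, begins_with (w01 k) x ->
            summable_from 1 (fun n => a (n + k)%N - la) /\
            W zeros x = \sum_(1 <= n <oo) (a (n + k)%N - la),
          summable_from 2 (fun n => a n - la) /\
          W zeros ones = lb - la + \sum_(2 <= n <oo) (a n - la) &
          forall x : Omega, begins_with (w10 k) x ->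
            summable_from 2 (fun n => a n - la) /\
            W zeros x = b k - la + \sum_(2 <= n <oo) (a n - la)],
      (* y = [0^l 1] *)
      forall y : Omega, begins_with (w01 l) y ->
      [/\ forall x : Omega, begins_with (w01 k) x ->
            W y x = \sum_(1 <= n < l.+1) (a (n + k)%N - la)
                    + d (l + k)%N - ld,
          W y ones = (lb - la) + \sum_(2 <= n < l.+1) (a n - la) + d l - ld &
          forall x : Omega, begins_with (w10 k) x ->
            W y x = b k - la + \sum_(2 <= n < l.+1) (a n - la) + d l - ld],
      (* y = 1^oo *)
      [/\ forall x : Omega, begins_with (w01 k) x ->
            W ones x = d k - ld,
          summable_from 2 (fun n => lc - c n) /\
          W ones ones = lc - ld + \sum_(2 <= n <oo) (lc - c n) &
          forall x : Omega, begins_with (w10 k) x ->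
            summable_from 2 (fun n => c (n + k)%N - c n) /\
            W ones x = c k.+1 - ld + \sum_(2 <= n <oo) (c (n + k)%N - c n)] &
      (* y = [1^l 0] *)
      forall y : Omega, begins_with (w10 l) y ->
      [/\ forall x : Omega, begins_with (w01 k) x ->
            W y x = d k - ld,
          W y ones = lc - ld + \sum_(2 <= n < l.+1) (lc - c n) + lb - b l &
          forall x : Omega, begins_with (w10 k) x ->
            W y x = c k.+1 - ld + \sum_(2 <= n < l.+1) (c (n + k)%N - c n)
                    + b (l + k)%N - b l]].
Proof.
have Ac : continuous A by case: A_walters.
have A0 := walters_zeros A_seqs Ac a_lim.
have A1 := walters_ones A_seqs Ac c_lim.
have A01 := walters_false_ones A_seqs Ac b_lim.
have A10 := walters_true_zeros A_seqs Ac d_lim.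
have zerosE n : prepend (nseq n false) zeros = zeros by exact: prepend_nseq_const.
have onesE n : prepend (nseq n true) ones = ones by exact: prepend_nseq_const.
split=> [y|k l k1 l1].
  rewrite /involution_kernel (@series_eventually0 _ 1 1) ?big_geq // => n _.
  exact: subrr.
(* [D u x] is the kernel term of a past equal to [u]. The subtracted value is [la] for 0^n, [ld] for
   1 0^j, [c n] for 1^n with n >= 2, and [b l] for 0 1^l. *)
pose D (u : seq bool) x := A (prepend u x) - A (prepend u zeros).
(* [Fi] and [Ti] are terms for a past of zeros resp. ones, [i] being the first
   letter of [x]. *)
have D_a n x : (2 <= n)%N -> x 0%N = true -> D (nseq n false) x = a n - la.
  by move=> n2 x0; rewrite /D (walters_a A_seqs) // zerosE A0.
have F0 n z : (1 <= n)%N -> z 0%N = true ->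
    D (nseq n false) (prepend (nseq k false) z) = a (n + k)%N - la.
  move=> n1 z0; rewrite /D prepend_nseqD zerosE A0 (walters_a A_seqs) //.
  by rewrite (leq_add n1 k1).
have F1 z : z 0%N = false ->
    D (nseq 1 false) (prepend (nseq k true) z) = b k - la.
  by move=> z0; rewrite /D zerosE A0 -prepend_cat (walters_b A_seqs).
have F1oo : D (nseq 1 false) ones = lb - la by rewrite /D zerosE A0 A01.
have T0 z : z 0%N = true ->
    D (nseq 1 true) (prepend (nseq k false) z) = d k - ld.
  by move=> z0; rewrite /D A10 -prepend_cat (walters_d A_seqs).
(* The run 1^n is followed by 0 in both points, so both values are [c n]. *)
have T0' n z : (2 <= n)%N -> D (nseq n true) (prepend (nseq k false) z) = 0.
  move=> n2; rewrite /D !(walters_c A_seqs) ?subrr //.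
  exact: prepend_nseq_head.
have T1 z : z 0%N = false ->
    D (nseq 1 true) (prepend (nseq k true) z) = c k.+1 - ld.
  by move=> z0; rewrite /D A10 prepend_nseqD (walters_c A_seqs).
have T1' n z : (2 <= n)%N -> z 0%N = false ->
    D (nseq n true) (prepend (nseq k true) z) = c (n + k)%N - c n.
  move=> n2 z0; rewrite /D prepend_nseqD !(walters_c A_seqs) //.
  exact: (leq_trans n2 (leq_addr _ _)).
have T1oo : D (nseq 1 true) ones = lc - ld by rewrite /D A10 onesE A1.
have T1oo' n : (2 <= n)%N -> D (nseq n true) ones = lc - c n.
  by move=> n2; rewrite /D onesE A1 (walters_c A_seqs).
have termE e x n : kernel_term A zeros (fun=> e) x n = D (nseq n e) x.
  by rewrite /kernel_term past_const.
have runE e x y : begins_with (rcons (nseq l e) (~~ e)) y ->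
    involution_kernel A zeros y x =
    \sum_(1 <= n < l.+1) D (nseq n e) x + D (~~ e :: nseq l e) x.
  exact: (involution_kernel_run A_seqs).
(* The term n = 1 is set apart: a one-letter run may need [b] or [d], while the later terms follow
   one formula [v]. *)
have runS e x y v : begins_with (rcons (nseq l e) (~~ e)) y ->
    (forall n, (2 <= n)%N -> D (nseq n e) x = v n) ->
    involution_kernel A zeros y x =
    D (nseq 1 e) x + \sum_(2 <= n < l.+1) v n + D (~~ e :: nseq l e) x.
  move=> yE Dv; rewrite (runE _ _ _ yE) big_ltn //; congr (_ + _ + _).
  by apply: eq_big_nat => n /andP[n2 _]; exact: Dv.
(* The counterpart for constant [y]: convergence from index 2 is inherited from the existence of the
   kernel. *)
have sumS e x v : (forall n, (2 <= n)%N -> D (nseq n e) x = v n) ->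
    summable_from 2 v /\
    involution_kernel A zeros (fun=> e) x =
      D (nseq 1 e) x + \sum_(2 <= n <oo) v n.
  move=> Dv; have [s2 WE] := summable_from_recl (W_exists (fun=> e) x).
  have [n n2|s2' vE] := eq_summable_from _ s2 (v := v).
    by rewrite termE Dv.
  by rewrite /involution_kernel WE vE termE.
split.
- split=> [x /begins_with_run[z z0 ->]||x /begins_with_run[z z0 ->]].
  (* Since [x] starts with 0, even the first term has a run of length 1 + k >= 2, and no term is set
     apart. *)
  + apply: eq_summable_from (W_exists _ _) => n n1.
    by rewrite termE F0.
  + by rewrite -F1oo; apply: sumS => n n2; rewrite D_a.
  + rewrite -(F1 z) //; apply: sumS => n n2.
    by rewrite D_a // prepend_nseq_head.
- move=> y yE.
  split=> [x /begins_with_run[z z0 ->]||x /begins_with_run[z z0 ->]].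
  + rewrite (runE false) //= -addrA; congr (_ + _).
      by apply: eq_big_nat => n /andP[n1 _]; rewrite F0.
    (* The last past 1 0^l merges with the run 0^k of [x], giving [d (l + k)]. *)
    rewrite /D (prepend_cat [:: true]) prepend_nseqD -prepend_cat.
    rewrite (prepend_cat [:: true] _ zeros) zerosE A10.
    by rewrite (walters_d A_seqs) // addn_gt0 l1.
  + rewrite (runS false _ _ (fun n => a n - la)) // => [|n n2]; last first.
      by rewrite D_a.
    rewrite F1oo -[RHS]addrA /D (walters_d A_seqs) //.
    by rewrite (prepend_cat [:: true]) zerosE A10.
  + rewrite (runS false _ _ (fun n => a n - la)) // => [|n n2]; last first.
      by rewrite D_a // prepend_nseq_head.
    rewrite F1 // -[RHS]addrA /D (walters_d A_seqs) ?prepend_nseq_head //.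
    by rewrite (prepend_cat [:: true]) zerosE A10.
- split=> [x /begins_with_run[z z0 ->]||x /begins_with_run[z z0 ->]].
  (* Only the term n = 1 survives, by [T0']. *)
  + rewrite /involution_kernel (@series_eventually0 _ 1 2) // => [|n n2].
      by rewrite big_nat1 termE T0.
    by rewrite termE T0'.
  + by rewrite -T1oo; apply: sumS.
  + by rewrite -(T1 z) //; apply: sumS => n n2; rewrite T1'.
- move=> y yE.
  split=> [x /begins_with_run[z z0 ->]||x /begins_with_run[z z0 ->]].
  + rewrite (runS true _ _ (fun=> 0)) // => [|n n2]; last by rewrite T0'.
    (* The last past 0 1^l is followed by 0 in both points, so the two values [b l] cancel. *)
    rewrite T0 // big1 // addr0 /D !(walters_b A_seqs) ?prepend_nseq_head //.
    by rewrite subrr addr0.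
  + rewrite (runS true _ _ (fun n => lc - c n)) // T1oo -[RHS]addrA.
    (* Only the base point gives [b l]; at [ones] the last past yields 0 1^oo, with value [lb]. *)
    rewrite /D (walters_b A_seqs (x := zeros) l1) //.
    by rewrite (prepend_cat [:: false]) onesE A01.
  + rewrite (runS true _ _ (fun n => c (n + k)%N - c n)) // => [|n n2]; last first.
      by rewrite T1'.
    rewrite T1 // -[RHS]addrA /D (walters_b A_seqs (x := zeros) l1) //.
    rewrite (prepend_cat [:: false]) prepend_nseqD -prepend_cat.
    by rewrite (walters_b A_seqs) // addn_gt0 l1.
Qed.
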